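(* Let $n\ge1$, $b\ge1$. Let $\mu_1,\mu_2,\dots$ be i.i.d. random elements of $B_n$ with law $Q^B_{2b+1}$, and set $\tau_0=\mathrm{id}$, $\tau_r=\tau_{r-1}\circ\mu_r$ (the result of $r$ successive $(2b+1)$-shuffles). Then $(d(\tau_r^{-1}))_{r\ge0}$ is a Markov chain on $\{0,\dots,n\}$ with stationary distribution $\pi(j)=\overline{A(n,j)}/(2^nn!)$, and its transition matrix $K$ satisfies $K(i,j)=\pi(j)P(j,i)/\pi(i)$, where $P$ is the transition matrix of the type $B$ base-$(2b+1)$ carries chain; i.e. its formal time reversal with respect to $\pi$ is the type $B$ carries chain.
   Context: $B_n$ is the group of signed permutations (bijections $\sigma$ of $\{\pm1,\dots,\pm n\}$ with $\sigma(-i)=-\sigma(i)$), composed as functions. With the order $1<2<\dots<n<-n<\dots<-1$, $\sigma$ has a descent at $i$ ($1\le i\le n-1$) if $\sigma(i)>\sigma(i+1)$ and at $n$ if $\sigma(n)<0$; $d(\sigma)$ is the number of descents and $\overline{A(n,j)}$ the number of $\sigma\in B_n$ with $j$ descents. Binomial convention: $\binom{m}{n}=0$ if $m<n$. The type $B$ $(2b+1)$-shuffle measure (cut multinomially into $2b+1$ piles, flip the even-numbered piles, riffle) is $Q^B_{2b+1}(\tau)=\binom{n+b-d(\tau^{-1})}{n}/(2b+1)^n$; a $(2a+1)$-shuffle followed by a $(2b+1)$-shuffle has law $Q^B_{(2a+1)(2b+1)}$. The type $B$ base-$(2b+1)$ carries chain is the Markov chain on $\{0,\dots,n\}$ with $\kappa_0=0$,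 $\kappa_{t+1}=\lfloor(\kappa_t+b+X_{t+1,1}+\dots+X_{t+1,n})/(2b+1)\rfloor$, $X_{t,k}$ i.i.d. uniform on $\{0,\dots,2b\}$. *)

(* Defs.v *)
From HB Require Import structures.
From mathcomp Require Import all_boot all_order all_algebra all_fingroup.
Set Implicit Arguments. Unset Strict Implicit. Unset Printing Implicit Defensive.
Import GRing.Theory Num.Theory.
Local Open Scope ring_scope.

(* The point (i, false) encodes the value i+1 and (i, true) the value -(i+1),
   for i : 'I_n.  A signed permutation is a permutation of these 2n points
   that commutes with negation. *)
Definition spt (n : nat) := ('I_n * bool)%type.
Definition negpt (n : nat) (x : spt n) : spt n := (x.1, ~~ x.2).
Definition Bn (n : nat) : {set {perm spt n}} :=
  [set s : {perm spt n} | [forall x, s (negpt x) == negpt (s x)]].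

Definition compose (n : nat) (s t : {perm spt n}) : {perm spt n} := (t * s)%g.

(* Position of a value in the order 1 < 2 < ... < n < -n < ... < -1. *)
Definition rank (n : nat) (x : spt n) : nat :=
  (if x.2 then 2 * n - 1 - x.1 else nat_of_ord x.1)%N.

Definition ndes (n : nat) (s : {perm spt n}) : nat :=
  let w := [seq s (i, false) | i <- enum 'I_n] in
  (count (fun p : spt n * spt n => (rank p.2 < rank p.1)%N) (zip w (behead w))
   + match w with [::] => 0 | x :: w' => nat_of_bool (last x w').2 end)%N.
Arguments ndes {n} s.

Definition AB (n j : nat) : nat := #|[set s in Bn n | ndes s == j]|.

Definition piB (n j : nat) : rat := (AB n j)%:R / (2 ^ n * n`!)%N%:R.

Definition QB (n b : nat) (s : {perm spt n}) : rat :=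
  ('C(n + b - ndes (s^-1)%g, n))%:R / ((2 * b + 1) ^ n)%N%:R.

Arguments QB : clear implicits.

Definition carriesB (n b i j : nat) : rat :=
  #|[set x : {ffun 'I_n -> 'I_(2 * b + 1)} |
       ((i + b + \sum_(k < n) nat_of_ord (x k)) %/ (2 * b + 1) == j)%N]|%:R
  / ((2 * b + 1) ^ n)%N%:R.

Fixpoint tau (n : nat) (mus : seq {perm spt n}) (k : nat) : {perm spt n} :=
  match k with
  | 0 => 1%g
  | k'.+1 => compose (tau mus k') (nth 1%g mus k')
  end.

Definition path_prob (n b r : nat) (j : 'I_r.+1 -> 'I_n.+1) : rat :=
  \sum_(mu : r.-tuple {perm spt n} | all (fun s => s \in Bn n) mu)
    (\prod_(k < r) QB n b (tnth mu k)) *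
    (([forall k : 'I_r.+1, ndes (tau mu k)^-1 == nat_of_ord (j k)] : bool)%:R).
Arguments path_prob : clear implicits.
Arguments carriesB : clear implicits.
Arguments piB : clear implicits.
Arguments AB : clear implicits.

Lemma compose_ok (n : nat) (s t : {perm spt n}) x : compose s t x = s (t x).
Proof. by rewrite /compose permM. Qed.

(* Main.v *)
Require Import Defs.
From HB Require Import structures.
From mathcomp Require Import all_boot all_order all_algebra all_fingroup zify ring.
Set Implicit Arguments. Unset Strict Implicit. Unset Printing Implicit Defensive.
Import GRing.Theory Num.Theory.
Local Open Scope nat_scope.

(* Read a signed permutation s as a centrally symmetric permutation of the 2n
   points in the order 1 < ... < n < -n < ... < -1.  Then 'C(n + a - d(s), n)
   counts the odd functions f with values in [-a, a] such that x |-> (f x, s x)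
   increases lexicographically.  Writing f in balanced base 2b+1 as a high and a
   low digit, and standardizing (low digit, rho) to a signed permutation s, gives
     sum_s C(n+a-d(s), n) C(n+b-d(rho s^-1), n) = C(n + a(2b+1) + b - d(rho), n).
   Dividing n-tuples of naturals of bounded sum by 2b+1 shows that the numbers
   N(d(rho), i) of digit vectors carrying d(rho) to i satisfy
     sum_i C(n+a-i, n) N(d(rho), i) = C(n + a(2b+1) + b - d(rho), n).
   Both hold for all a, and ['C(n+a-i, n)] is unitriangular, so the shuffle mass
   reaching t from all s with d(s^-1) = i is the carries probability
   P(d(t^-1), i).  It depends on t only through d(t^-1), which is weak
   lumpability with the reversed chain P. *)

(** * Ranks of points, negation, and the group of signed permutations *)

Lemma card_in_bij (T U : finType) (A : {set T}) (B : {set U})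
    (f : T -> U) (g : U -> T) :
  {in A, forall x, f x \in B} -> {in B, forall y, g y \in A} ->
  {in A, cancel f g} -> {in B, cancel g f} -> #|A| = #|B|.
Proof.
move=> fB gA fK gK; rewrite -(card_in_imset (can_in_inj fK)).
congr (#|pred_of_set _|); apply/setP=> y; apply/imsetP/idP => [[x xA ->]|yB].
  exact: fB.
by exists (g y); [exact: gA | rewrite gK].
Qed.

Lemma rank_lt n (x : spt n) : rank x < 2 * n.
Proof. by case: x => i [] /=; rewrite /rank /=; have := ltn_ord i; lia. Qed.

Lemma rank_neg n (x : spt n) : rank (negpt x) = 2 * n - 1 - rank x.
Proof. by case: x => i [] /=; rewrite /rank /=; have := ltn_ord i; lia. Qed.

Lemma rank_inj n : injective (@rank n).
Proof.
move=> [i c] [j d]; rewrite /rank /=; have := ltn_ord i; have := ltn_ord j.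
by case: c; case: d => ? ? ?; first [lia | congr pair; apply: val_inj => /=; lia].
Qed.

Lemma negptK n : involutive (@negpt n).
Proof. by case=> i c; rewrite /negpt /= negbK. Qed.

Lemma rank_onto n k : k < 2 * n -> exists x : spt n, rank x = k.
Proof.
move=> lkn; case: (ltnP k n) => [lk|lk]; first by exists (Ordinal lk, false).
have lk' : 2 * n - 1 - k < n by lia.
by exists (Ordinal lk', true); rewrite /rank /=; lia.
Qed.

Lemma Bn_neg n (s : {perm spt n}) x : s \in Bn n -> s (negpt x) = negpt (s x).
Proof. by rewrite inE => /forallP/(_ x)/eqP. Qed.

Lemma BnP n (s : {perm spt n}) :
  (forall x, s (negpt x) = negpt (s x)) -> s \in Bn n.
Proof. by move=> H; rewrite inE; apply/forallP => x; rewrite H. Qed.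

Lemma Bn_group_set n : group_set (Bn n).
Proof.
apply/group_setP; split; first by apply: BnP => x; rewrite !perm1.
by move=> s t sB tB; apply: BnP => x; rewrite !permM !Bn_neg.
Qed.
Canonical Bn_group n := Group (Bn_group_set n).

(** * Counting weakly increasing sequences with prescribed strict steps *)

(** The bound [a] acts as an extra last term, so the final entry of [e] decides whether the last
    value may equal [a]. This step will carry the type B descent at the end of the word. *)
Definition chain n a (e : nat -> bool) (u : nat -> nat) :=
  [forall k : 'I_n, u k + e k <= if k.+1 < n then u k.+1 else a].

Lemma chainP n a (e : nat -> bool) u :
  reflect (forall k, k < n -> u k + e k <= if k.+1 < n then u k.+1 else a)
          (chain n a e u).
Proof.
by apply: (iffP forallP) => [H k kn|H k]; [exact: (H (Ordinal kn)) | exact: H].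
Qed.

Lemma sum_bool_leq (e : nat -> bool) k : \sum_(i < k) e i <= k.
Proof.
rewrite -[X in _ <= X]card_ord -sum1_card; apply: leq_sum => i _.
by case: (e i).
Qed.

Lemma leq_sum_prefix (e : nat -> bool) k n : k <= n ->
  \sum_(i < k) e i <= \sum_(i < n) e i.
Proof.
move=> kn; rewrite -(big_mkord xpredT (fun i => nat_of_bool (e i))).
rewrite -(big_mkord xpredT (fun i => nat_of_bool (e i))).
by rewrite (big_cat_nat _ kn) //= leq_addr.
Qed.

Lemma chain_bound {n a} {e : nat -> bool} {u k} : chain n a e u -> k < n ->
  u k + \sum_(i < n) e i <= a + \sum_(i < k) e i.
Proof.
move=> /chainP H lkn.
have [d Ed] : exists d, n = k + d.+1 by exists (n - k.+1); lia.
elim: d k lkn Ed => [|d IH] k lkn Ed.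
  have -> : n = k.+1 by lia.
  by rewrite big_ord_recr /=; have := H k lkn; rewrite ifF; lia.
have := IH k.+1; rewrite big_ord_recr /=; have := H k lkn; rewrite ifT; lia.
Qed.

Lemma ltn_sorted_tupleP m q (t : m.-tuple 'I_q.+1) :
  reflect (forall i j : 'I_m, j = i.+1 :> nat -> tnth t i < tnth t j)
          (sorted ltn [seq val i | i <- t]).
Proof.
apply: (iffP (sortedP 0)) => [H i j Eij|H i].
  have := H i; rewrite size_map size_tuple -Eij => /(_ (ltn_ord _)).
  by rewrite !(nth_map ord0) ?size_tuple ?ltn_ord // -!tnth_nth.
rewrite size_map size_tuple => Hi; rewrite !(nth_map ord0) ?size_tuple ?(ltnW Hi) //.
by have := H (Ordinal (ltnW Hi)) (Ordinal Hi) erefl; rewrite !(tnth_nth ord0).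
Qed.

(* The number of non-strict steps before [k] is added to [u k] to make the chain
   strictly increasing. *)
Lemma card_chain n a (e : nat -> bool) :
  #|[set u : {ffun 'I_n.+1 -> 'I_a.+1} | chain n.+1 a e (fun k => u (inord k))]|
  = 'C(n.+1 + a - \sum_(k < n.+1) e k, n.+1).
Proof.
rewrite -card_ltn_sorted_tuples; set d := \sum_(k < n.+1) _.
have dn : d <= n.+1 by exact: sum_bool_leq.
have dk k : k <= n.+1 -> \sum_(i < k) e i <= d by exact: leq_sum_prefix.
pose asc k := k - \sum_(i < k) e i.
have ascS k : asc k.+1 = asc k + ~~ e k.
  by rewrite /asc big_ord_recr /=; have := sum_bool_leq e k; case: (e k) => /=; lia.
(* The empty range is treated apart because [inord] needs ordinals ['I_q.+1]. There [d = n.+1] and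
   [a = 0], so no chain satisfies [u 0 + d <= a]. *)
case: (posnP (n.+1 + a - d)) => [E0|d0].
  rewrite E0 card_ltn_sorted_tuples bin0n /=; apply: eq_card0 => u.
  rewrite inE; apply/negP => /chain_bound - /(_ 0 isT).
  by rewrite big_ord0 -/d; lia.
have [q Eq] : exists q, n.+1 + a - d = q.+1 by exists (n.+1 + a - d).-1; lia.
rewrite Eq.
pose F (u : {ffun 'I_n.+1 -> 'I_a.+1}) : n.+1.-tuple 'I_q.+1 :=
  [tuple inord (u i + asc i) | i < n.+1].
pose G (t : n.+1.-tuple 'I_q.+1) : {ffun 'I_n.+1 -> 'I_a.+1} :=
  [ffun i => inord (tnth t i - asc i)].
have Fb (u : {ffun 'I_n.+1 -> 'I_a.+1}) (i : 'I_n.+1) :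
    chain n.+1 a e (fun k => u (inord k)) -> u i + asc i < q.+1.
  move/chain_bound => /(_ i (ltn_ord i)); rewrite inord_val -/d /asc.
  by have := sum_bool_leq e i; have := ltn_ord i; have := dk i (ltnW (ltn_ord i)); lia.
have srt (t : n.+1.-tuple 'I_q.+1) := elimT (ltn_sorted_tupleP t).
(* As [asc i <= i], this lower bound keeps the subtraction in [G] from truncating. *)
have tlow (t : n.+1.-tuple 'I_q.+1) : sorted ltn [seq val i | i <- t] ->
    forall i : 'I_n.+1, i <= tnth t i.
  move=> /srt H [i]; elim: i => // i IH Hi.
  exact: leq_ltn_trans (IH (ltnW Hi)) (H (Ordinal (ltnW Hi)) (Ordinal Hi) erefl).
(* Room must remain for the strict steps from [i] on. The induction runs down from the last index,
   where the bound is the size of ['I_q.+1]. *)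
have Gb (t : n.+1.-tuple 'I_q.+1) : sorted ltn [seq val i | i <- t] ->
    forall i : 'I_n.+1, tnth t i - asc i <= a - (d - \sum_(k < i) e k).
  move=> H i; have [m] := ubnP (n - i); elim: m i => // m IH i Hm.
  have := tlow _ H i; have := ascS i; rewrite {3}/asc.
  have := dk i.+1 (ltn_ord i); rewrite big_ord_recr /=.
  have := sum_bool_leq e i => ? ? ? ?.
  case: (ltnP i n) => Hi.
    have := IH (inord i.+1); rewrite inordK; last by lia.
    move/(_ ltac:(lia)); have := srt _ H i (inord i.+1).
    rewrite inordK; last by lia.
    move/(_ erefl); rewrite ascS big_ord_recr /=; move: (ltn_ord i).
    rewrite /asc; case: (e i) => /=; lia.
  have Ei : i = n :> nat by have := ltn_ord i; lia.
  have : d = \sum_(k < i) e k + e i by rewrite Ei /d big_ord_recr.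
  by have := ltn_ord (tnth t i); rewrite /asc; case: (e i) => /=; lia.
apply: (@card_in_bij _ _ _ _ F G) => [u|t|u|t]; rewrite !inE.
- move=> uc; apply/ltn_sorted_tupleP => i j Eij; rewrite !tnth_mktuple.
  rewrite !inordK; [|exact: Fb..]; rewrite Eij ascS.
  have /chainP /(_ i (ltn_ord i)) := uc; rewrite -Eij ltn_ord !inord_val.
  by case: (e i) => /=; lia.
- move=> ts; apply/chainP => k Hk; rewrite !ffunE.
  have GB := Gb t ts; have TL := tlow t ts.
  rewrite inordK; last by have := GB (inord k); lia.
  have := TL (inord k); have := GB (inord k); rewrite inordK // => gb tl.
  have := ascS k; rewrite {2}/asc; have := sum_bool_leq e k.
  have := dk k.+1 Hk; rewrite big_ord_recr /= => ? ? ?.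
  case: ifP => Hk1.
    rewrite inordK; last by have := GB (inord k.+1); lia.
    have := srt t ts (inord k) (inord k.+1); rewrite !inordK // => /(_ erefl).
    by rewrite ascS /asc; case: (e k) => /=; lia.
  have Ek : k = n by lia.
  have Ed : d = \sum_(i < k) e i + e k by rewrite /d Ek big_ord_recr.
  have := ltn_ord (tnth t (inord k)); rewrite /asc.
  by case: (e k) Ed => /=; lia.
- move=> uc; apply/ffunP => i; rewrite ffunE tnth_mktuple; apply: val_inj.
  by rewrite /= inordK inordK ?addnK //; [exact: Fb | exact: Fb].
- move=> ts; apply: eq_from_tnth => i; rewrite tnth_mktuple ffunE; apply: val_inj => /=.
  have := tlow t ts i; have := Gb t ts i => gb tl.
  have -> : nat_of_ord (inord (tnth t i - asc i) : 'I_a.+1) = tnth t i - asc i.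
    by apply: inordK; rewrite ltnS; apply: leq_trans gb (leq_subr _ _).
  rewrite subnK; first by rewrite inord_val.
  exact: leq_trans (leq_subr _ _) tl.
Qed.

(** * Odd functions compatible with a signed permutation *)

(** Ranks are below [2 * n], so comparing keys compares the pairs [(f x, rank (s x))]
    lexicographically. *)
Definition key n m (f : {ffun spt n -> 'I_m}) (s : {perm spt n}) (x : spt n) :=
  f x * (2 * n) + rank (s x).

(** The integer v in [-a, a] is stored as v + a in ['I_(2 * a).+1], where [rev_ord] is negation. *)
Definition oddf n m (f : {ffun spt n -> 'I_m}) :=
  [forall x, f (negpt x) == rev_ord (f x)].

Definition compat n a (s : {perm spt n}) : {set {ffun spt n -> 'I_(2 * a).+1}} :=
  [set f | oddf f
         && [forall x, forall y, (rank x < rank y) ==> (key f s x < key f s y)]].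

Lemma oddfP n a (f : {ffun spt n -> 'I_(2 * a).+1}) :
  reflect (forall x, f (negpt x) = 2 * a - f x :> nat) (oddf f).
Proof.
apply: (iffP forallP) => H x; first by rewrite (eqP (H x)) /= subSS.
by apply/eqP/val_inj; rewrite /= H subSS.
Qed.

Lemma compatP n a (s : {perm spt n}) (f : {ffun spt n -> 'I_(2 * a).+1}) :
  reflect (oddf f /\ forall x y, rank x < rank y -> key f s x < key f s y)
          (f \in compat a s).
Proof.
rewrite inE; apply: (iffP andP) => -[fo H]; split=> //.
  by move=> x y; have /forallP/(_ x)/forallP/(_ y)/implyP := H.
by apply/forallP => x; apply/forallP => y; apply/implyP/H.
Qed.

(** * Points by position, and descents of the full symmetric word *)

Definition pt n k : spt n.+1 :=
  if k < n.+1 then (inord k, false) else (inord (2 * n + 1 - k), true).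

Lemma rank_pt n k : k < 2 * n.+1 -> rank (pt n k) = k.
Proof.
by rewrite /rank /pt => lk; case: ltnP => /= ?; rewrite inordK; lia.
Qed.

Lemma pt_rank n (x : spt n.+1) : pt n (rank x) = x.
Proof. by apply: rank_inj; rewrite rank_pt ?rank_lt. Qed.

Lemma negpt_pt n k : k < 2 * n.+1 -> negpt (pt n k) = pt n (2 * n + 1 - k).
Proof.
move=> lk; apply: rank_inj; rewrite rank_neg !rank_pt //; lia.
Qed.

(** At [k = n] the two points are opposite, so a value is compared with its negative: a descent
    there means that the value is negative. The special last descent of type B thus becomes an
    ordinary one. *)
Definition desc n (s : {perm spt n.+1}) k : bool :=
  rank (s (pt n k.+1)) < rank (s (pt n k)).

Lemma count_zip_iota (T : Type) (g : nat -> T) (P : pred (T * T)) m n :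
  count P (zip (map g (iota m n.+1)) (map g (iota m.+1 n))) =
  \sum_(k < n) P (g (m + k), g (m + k).+1).
Proof.
elim: n m => [|n IH] m; first by rewrite big_ord0.
rewrite big_ord_recl /= addn0; congr (_ + _).
have /= -> := IH m.+1; apply: eq_bigr => i _.
by rewrite /bump /= addSnnS.
Qed.

Lemma ndesE n (s : {perm spt n.+1}) :
  s \in Bn n.+1 -> ndes s = \sum_(k < n.+1) desc s k.
Proof.
move=> sB; rewrite /ndes.
have -> : [seq s (i, false) | i <- enum 'I_n.+1] =
          map (fun k => s (pt n k)) (iota 0 n.+1).
  rewrite -val_enum_ord -map_comp; apply: eq_map => i /=.
  by rewrite /pt ltn_ord inord_val.
rewrite count_zip_iota big_ord_recr /= last_map; congr (_ + _).
have -> : last 0 (iota 1 n) = n.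
  case: n {s sB} => // n; rewrite (last_nth 0) size_iota.
  by rewrite -[LHS]/(nth 0 (iota 0 n.+2) n.+1) nth_iota.
rewrite /desc; have -> : pt n n.+1 = negpt (pt n n).
  by rewrite negpt_pt; last lia; congr pt; lia.
rewrite Bn_neg // rank_neg; congr nat_of_bool.
by case: (s _) => i [] /=; rewrite /rank /=; have := ltn_ord i; lia.
Qed.

Lemma ndes_le n (s : {perm spt n.+1}) : s \in Bn n.+1 -> ndes s <= n.+1.
Proof. by move/ndesE ->; exact: sum_bool_leq. Qed.

(* [s] commutes with the reversal [k |-> 2n+1-k] of the points [pt n k]. *)
Lemma desc_sym n (s : {perm spt n.+1}) k : s \in Bn n.+1 -> k <= 2 * n ->
  desc s (2 * n - k) = desc s k.
Proof.
move=> sB lk; rewrite /desc.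
have -> : pt n (2 * n - k) = negpt (pt n k.+1).
  by rewrite negpt_pt; [congr pt; lia | lia].
have -> : pt n (2 * n - k).+1 = negpt (pt n k).
  by rewrite negpt_pt; [congr pt; lia | lia].
rewrite !Bn_neg // !rank_neg.
by have := rank_lt (s (pt n k)); have := rank_lt (s (pt n k.+1)); lia.
Qed.

(** Neighbouring ranks differ by less than [2 * n.+1] and are distinct, so the value of [f] may stay
    constant at an ascent and must grow at a descent. *)
Lemma key_stepE n m (f : {ffun spt n.+1 -> 'I_m}) s k : k.+1 < 2 * n.+1 ->
  (key f s (pt n k) < key f s (pt n k.+1)) =
  (f (pt n k) + desc s k <= f (pt n k.+1)).
Proof.
move=> lk; rewrite /key /desc.
have := rank_lt (s (pt n k)); have := rank_lt (s (pt n k.+1)).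
have : rank (s (pt n k)) != rank (s (pt n k.+1)).
  apply/eqP => /rank_inj/perm_inj/(congr1 (@rank _)); rewrite !rank_pt; lia.
move: (rank _) (rank _) (nat_of_ord _) (nat_of_ord _) => r1 r2 v1 v2.
case: (ltnP r2 r1) => /=; nia.
Qed.

Lemma compat_step n a (s : {perm spt n.+1}) (f : {ffun spt n.+1 -> 'I_(2 * a).+1}) :
  oddf f ->
  (forall k, k.+1 < 2 * n.+1 -> f (pt n k) + desc s k <= f (pt n k.+1)) ->
  f \in compat a s.
Proof.
move=> fo H; apply/compatP; split=> // x y lxy.
rewrite -[x]pt_rank -[y]pt_rank.
have := homo_ltn_in (D := [pred k | k < 2 * n.+1])
  (f := fun k => key f s (pt n k)) (r := fun u v => u < v) ltn_trans.
apply; rewrite ?inE ?rank_lt //.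
  by move=> i j; rewrite !inE => _ lj k; rewrite inE; lia.
by move=> i _; rewrite inE => Hi; rewrite key_stepE // H.
Qed.

(* An odd function is determined by its values on the positive points, and the
   step across the middle reads [u n + desc <= a]. *)
Lemma card_compat n a (s : {perm spt n.+1}) : s \in Bn n.+1 ->
  #|compat a s| = 'C(n.+1 + a - ndes s, n.+1).
Proof.
move=> sB; rewrite ndesE // -card_chain.
pose F (f : {ffun spt n.+1 -> 'I_(2 * a).+1}) : {ffun 'I_n.+1 -> 'I_a.+1} :=
  [ffun i => inord (f (i, false))].
pose G (u : {ffun 'I_n.+1 -> 'I_a.+1}) : {ffun spt n.+1 -> 'I_(2 * a).+1} :=
  [ffun x => inord (if x.2 then 2 * a - u x.1 else u x.1)].
have GE u x : G u x = (if x.2 then 2 * a - u x.1 else u x.1) :> nat.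
  by rewrite ffunE inordK //; case: (x.2); have := ltn_ord (u x.1); lia.
have Godd u : oddf (G u).
  apply/oddfP => x; rewrite !GE /=; case: x => i [] //=.
  by have := ltn_ord (u i); lia.
have ptF k : k < n.+1 -> pt n k = (inord k, false) by rewrite /pt => ->.
have step f : f \in compat a s -> forall k, k < n.+1 ->
    f (pt n k) + desc s k <= if k.+1 < n.+1 then f (pt n k.+1) : nat else a.
  move=> /compatP[/oddfP fo fs] k Hk.
  have := fs (pt n k) (pt n k.+1); rewrite !rank_pt; try lia.
  rewrite key_stepE; last by lia.
  move=> /(_ (leqnn _)); case: ifP => // Hk1.
  (* Across the middle, oddness gives 2v + e <= 2a with e in {0, 1}, and parity yields v + e <=
     a. *)
  have -> : pt n k.+1 = negpt (pt n k) by rewrite negpt_pt; [congr pt|]; lia.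
  by rewrite fo; case: (f (pt n k)) (desc s k) => v lv [] /=; lia.
have Fle f i : f \in compat a s -> f (i, false) <= a.
  move=> /step/chainP/chain_bound/(_ (ltn_ord i)).
  rewrite ptF ?ltn_ord // inord_val => H.
  rewrite -(leq_add2r (\sum_(k < n.+1) desc s k)); apply: leq_trans H _.
  by rewrite leq_add2l leq_sum_prefix // ltnW.
have FE f i : f \in compat a s -> F f i = f (i, false) :> nat.
  by move=> fc; rewrite ffunE inordK // ltnS Fle.
apply: (card_in_bij (f := F) (g := G)) => [f fc|u|f fc|u].
- rewrite inE; apply/chainP => k Hk; rewrite !FE //.
  by have := step f fc k Hk; case: ifP => Hk1; rewrite !ptF.
- rewrite inE => /chainP uc; apply: compat_step (Godd u) _.
  have low k : k < n.+1 -> G u (pt n k) + desc s k <= G u (pt n k.+1).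
    move=> Hk; have := uc k Hk; case: ifP => Hk1; first by rewrite !ptF // !GE.
    have -> : pt n k.+1 = negpt (pt n k) by rewrite negpt_pt; [congr pt|]; lia.
    by rewrite ptF // !GE /=; lia.
  move=> k Hk; case: (ltnP k n.+1) => [|Hkn]; first exact: low.
  (* Beyond the middle, the step at [k] is the mirror image of the step at [2 * n - k]. *)
  have := low (2 * n - k); rewrite desc_sym //; try lia.
  have /oddfP Go := Godd u.
  have -> : pt n (2 * n - k) = negpt (pt n k.+1).
    by rewrite negpt_pt; [congr pt; lia | lia].
  have -> : pt n (2 * n - k).+1 = negpt (pt n k).
    by rewrite negpt_pt; [congr pt; lia | lia].
  move=> /(_ ltac:(lia)); rewrite !Go.
  by have := ltn_ord (G u (pt n k)); have := ltn_ord (G u (pt n k.+1)); lia.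
- have /compatP[/oddfP fo _] := fc.
  apply/ffunP => -[i c]; apply: val_inj => /=; rewrite GE /= FE //.
  by case: c => //; rewrite -fo.
- rewrite inE => uc; apply/ffunP => i; apply: val_inj; rewrite /= ffunE GE /=.
  by rewrite inordK.
Qed.

(** * Standardization and the shuffle convolution *)

Lemma card_rank_lt n r : r <= 2 * n -> #|[set z : spt n | rank z < r]| = r.
Proof.
elim: r => [|r IH] lr; first by apply: eq_card0 => z; rewrite inE.
have [z Ez] := rank_onto lr.
rewrite -[in RHS](IH (ltnW lr)) -[in RHS]add1n -[RHS]/(true + _).
have -> : true = (z \notin [set z : spt n | rank z < r]) by rewrite inE Ez ltnn.
rewrite -cardsU1; congr #|pred_of_set _|; apply/setP => y.
rewrite !inE ltnS leq_eqVlt -Ez; congr (_ || _).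
by apply/eqP/eqP => [/rank_inj|->].
Qed.

(** This recovers [s] from the comparisons between its values, whence the uniqueness of
    standardization. *)
Lemma card_perm_rank_lt n (s : {perm spt n}) x :
  #|[set y | rank (s y) < rank (s x)]| = rank (s x).
Proof.
rewrite -[RHS](card_rank_lt (ltnW (rank_lt (s x)))).
rewrite -(card_imset _ (@perm_inj _ s)); congr #|pred_of_set _|.
apply/setP => y; apply/imsetP/idP => [[z]|]; rewrite inE; first by move=> lz ->; rewrite inE.
by move=> ly; exists (s^-1%g y); rewrite ?inE permKV.
Qed.

Section Standardization.
Variables (n c : nat) (K : spt n -> nat).
Hypotheses (K_inj : injective K) (K_neg : forall x, K (negpt x) + K x = c).

Let r x := #|[set y | K y < K x]|.

Lemma below_lt x y : (r x < r y) = (K x < K y).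
Proof.
have H u v : K u < K v -> r u < r v.
  move=> luv; apply: proper_card; apply/properP; split.
    by apply/subsetP => z; rewrite !inE => /ltn_trans; apply.
  by exists u; rewrite !inE ?ltnn.
case: (ltngtP (K x) (K y)) => [/H //|/H|/K_inj ->]; last by rewrite ltnn.
by lia.
Qed.

(** By [K_neg], negation reverses the order given by [K]: points below -x are the opposites of
    points above x. The [2 * n] points split into those below x, x itself and those above. *)
Lemma below_neg x : r (negpt x) = 2 * n - 1 - r x.
Proof.
have E : r (negpt x) = #|[set y | K x < K y]|.
  rewrite /r -(card_imset _ (inv_inj (@negptK n))); congr #|pred_of_set _|.
  apply/setP => y; have := K_neg y; have := K_neg x => Ex Ey.
  apply/imsetP/idP => [[z]|]; rewrite inE.
    by move=> lz ->; rewrite inE; have := K_neg z; lia.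
  by move=> ly; exists (negpt y); rewrite ?negptK // inE; lia.
have : r x + r (negpt x) + 1 = 2 * n.
  rewrite E; have -> : 2 * n = #|[set: spt n]|.
    by rewrite cardsT card_prod card_ord card_bool mulnC.
  rewrite -[[set: _]](setUCr [set y | K y <= K x]) cardsU.
  rewrite [X in _ + _ - X]eq_card0 ?subn0; last by move=> y; rewrite !inE andbN.
  have -> : ~: [set y | K y <= K x] = [set y | K x < K y].
    by apply/setP => y; rewrite !inE ltnNge.
  rewrite -(cards1 x); have -> : [set y | K y <= K x] = [set y | K y < K x] :|: [set x].
    apply/setP => y; rewrite !inE leq_eqVlt orbC; congr (_ || _).
    by apply/eqP/eqP => [/K_inj|->].
  rewrite cardsU [X in _ + _ - X + _]eq_card0 ?subn0; first by rewrite /r addnAC.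
  by move=> y; rewrite !inE; case: eqP => [->|]; rewrite ?ltnn ?andbF.
by lia.
Qed.

Lemma standardization_exists :
  exists2 s, s \in Bn n & forall x y, (rank (s x) < rank (s y)) = (K x < K y).
Proof.
have r_lt x : r x < 2 * n by have := below_neg x; have := below_neg (negpt x);
  rewrite negptK; have := rank_lt x; lia.
(* The default is never taken, because [r x < 2 * n] is the rank of some point. *)
pose f x := odflt x [pick z | rank z == r x].
have fE x : rank (f x) = r x.
  rewrite /f; case: pickP => [z /eqP //|H].
  by have [z /eqP] := rank_onto (r_lt x); rewrite H.
have f_inj : injective f.
  move=> x y /(congr1 (@rank n)); rewrite !fE => E; apply: K_inj.
  by have := below_lt x y; have := below_lt y x; lia.
exists (perm f_inj) => [|x y]; last by rewrite !permE !fE below_lt.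
by apply: BnP => x; apply: rank_inj; rewrite rank_neg !permE !fE below_neg.
Qed.

End Standardization.

Lemma standardization_unique n (K : spt n -> nat) (s t : {perm spt n}) :
  (forall x y, (rank (s x) < rank (s y)) = (K x < K y)) ->
  (forall x y, (rank (t x) < rank (t y)) = (K x < K y)) -> s = t.
Proof.
move=> Hs Ht; apply/permP => x; apply: rank_inj.
rewrite -(card_perm_rank_lt s) -(card_perm_rank_lt t); apply: eq_card => y.
by rewrite !inE Hs Ht.
Qed.

Lemma ltn_lex m v1 r1 v2 r2 : r1 < m -> r2 < m ->
  (v1 * m + r1 < v2 * m + r2) = (v1 < v2) || (v1 == v2) && (r1 < r2).
Proof. by move=> l1 l2; case: (ltngtP v1 v2) => [||->] /=; nia. Qed.

(** Adding a number to its opposite gives high part g' + g and low part h' + h in [0, 4b], with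
    total 2a(2b+1) + 2b. This forces g' + g = 2a, so negation acts digit by digit. *)
Lemma balanced_digits a b g h g' h' : g <= 2 * a -> h <= 2 * b -> h' <= 2 * b ->
  g' * (2 * b).+1 + h' = 2 * (a * (2 * b + 1) + b) - (g * (2 * b).+1 + h) ->
  g' = 2 * a - g /\ h' = 2 * b - h.
Proof.
move=> lg lh lh' H.
have H' : (g' + g) * (2 * b).+1 + (h' + h) = 2 * a * (2 * b).+1 + 2 * b.
  have : g * (2 * b).+1 <= 2 * a * (2 * b).+1 by rewrite leq_mul2r lg orbT.
  lia.
case: (ltngtP (g' + g) (2 * a)) => E; last first.
- by rewrite E in H'; lia.
- have : (2 * a).+1 * (2 * b).+1 <= (g' + g) * (2 * b).+1 by rewrite leq_mul2r E orbT.
  by rewrite mulSn; lia.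
- have : (g' + g).+1 * (2 * b).+1 <= 2 * a * (2 * b).+1 by rewrite leq_mul2r E orbT.
  by rewrite mulSn; lia.
Qed.

Lemma key_inj n m (h : {ffun spt n -> 'I_m}) (s : {perm spt n}) :
  injective (key h s).
Proof.
move=> x y E; apply: (@perm_inj _ s); apply: rank_inj.
have : rank (s x) = key h s x %% (2 * n).
  by rewrite /key modnMDl modn_small ?rank_lt.
by rewrite E /key modnMDl modn_small ?rank_lt.
Qed.

Lemma key_neg n b (h : {ffun spt n -> 'I_(2 * b).+1}) (s : {perm spt n}) x :
  oddf h -> s \in Bn n -> key h s (negpt x) + key h s x = 2 * b * (2 * n) + (2 * n - 1).
Proof.
move=> /oddfP ho sB; rewrite /key ho Bn_neg // rank_neg.
have := rank_lt (s x); have := ltn_ord (h x); nia.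
Qed.

Lemma key_lt n m (h : {ffun spt n -> 'I_m}) (s : {perm spt n}) x :
  key h s x < m * (2 * n).
Proof. by rewrite /key; have := rank_lt (s x); have := ltn_ord (h x); nia. Qed.

(** That is, [s] standardizes the pairs [(h x, rho x)]. *)
Definition sorts n m (h : {ffun spt n -> 'I_m}) (rho s : {perm spt n}) :=
  [forall x, forall y, (rank (s x) < rank (s y)) == (key h rho x < key h rho y)].

Lemma sortsP n m (h : {ffun spt n -> 'I_m}) (rho s : {perm spt n}) :
  reflect (forall x y, (rank (s x) < rank (s y)) = (key h rho x < key h rho y))
          (sorts h rho s).
Proof.
apply: (iffP forallP) => [H x y|H x]; first by have /forallP/(_ y)/eqP := H x.
by apply/forallP => y; rewrite H.
Qed.

(** Existence and uniqueness of the standardization, put as a sum of indicators so that it can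
    replace a 1 in a count. *)
Lemma sum_sorts n b (h : {ffun spt n -> 'I_(2 * b).+1}) (rho : {perm spt n}) :
  oddf h -> rho \in Bn n -> \sum_(s in Bn n) sorts h rho s = 1.
Proof.
move=> ho rB; have [s sB sK] := standardization_exists (@key_inj _ _ h rho)
  (fun x => key_neg x ho rB).
rewrite (bigD1 s) //= big1 ?addn0 => [|t /andP[_ nt]]; last first.
  apply/eqP; rewrite eqb0; apply: contra nt => /sortsP tK.
  exact/eqP/(standardization_unique tK).
by have /sortsP -> := sK.
Qed.

Section Digits.
Variables (n a b : nat).
Let c := a * (2 * b + 1) + b.
Implicit Types (s rho : {perm spt n}).

(* Values in [-a, a] are stored shifted by [a]; the shifted base [2b+1] digits
   are then the shifted balanced digits. *)
Definition hi_digit (f : {ffun spt n -> 'I_(2 * c).+1}) :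
    {ffun spt n -> 'I_(2 * a).+1} :=
  [ffun x => inord (f x %/ (2 * b).+1)].
Definition lo_digit (f : {ffun spt n -> 'I_(2 * c).+1}) :
    {ffun spt n -> 'I_(2 * b).+1} :=
  [ffun x => inord (f x %% (2 * b).+1)].
Definition of_digits (g : {ffun spt n -> 'I_(2 * a).+1})
    (h : {ffun spt n -> 'I_(2 * b).+1}) : {ffun spt n -> 'I_(2 * c).+1} :=
  [ffun x => inord (g x * (2 * b).+1 + h x)].

Lemma of_digitsE g h x : of_digits g h x = g x * (2 * b).+1 + h x :> nat.
Proof.
rewrite ffunE inordK // /c; have := ltn_ord (g x); have := ltn_ord (h x); nia.
Qed.

Lemma of_digitsK f : of_digits (hi_digit f) (lo_digit f) = f.
Proof.
apply/ffunP => x; apply: val_inj; rewrite /= of_digitsE !ffunE !inordK.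
- by rewrite -divn_eq.
- by rewrite ltn_mod.
- by rewrite ltn_divLR //; have := ltn_ord (f x); rewrite /c; nia.
Qed.

Lemma hi_of_digits g h : hi_digit (of_digits g h) = g.
Proof.
apply/ffunP => x; apply: val_inj; rewrite /= ffunE of_digitsE.
by rewrite divnMDl // divn_small // addn0 inordK.
Qed.

Lemma lo_of_digits g h : lo_digit (of_digits g h) = h.
Proof.
apply/ffunP => x; apply: val_inj; rewrite /= ffunE of_digitsE.
by rewrite modnMDl modn_small // inordK.
Qed.

Lemma odd_of_digits g h : oddf (of_digits g h) = oddf g && oddf h.
Proof.
have E x : of_digits g h (negpt x) = g (negpt x) * (2 * b).+1 + h (negpt x) :> nat.
  exact: of_digitsE.
apply/oddfP/andP => [H|[/oddfP go /oddfP ho] x]; last first.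
  rewrite E go ho of_digitsE /c.
  have := ltn_ord (g x); have := ltn_ord (h x); nia.
have D x : g (negpt x) = 2 * a - g x :> nat /\ h (negpt x) = 2 * b - h x :> nat.
  by apply: balanced_digits; rewrite -1?ltnS // -E H of_digitsE.
by split; apply/oddfP => x; case: (D x).
Qed.

Lemma key_of_digits g h rho x :
  key (of_digits g h) rho x = g x * ((2 * b).+1 * (2 * n)) + key h rho x.
Proof. by rewrite /key of_digitsE mulnDl -mulnA addnA. Qed.

(** The key of the combined function compares [g] first and [key h rho] next. Since [s] sorts the
    latter, it may be replaced by [rank (s x)], which leaves the key of [g] and [s]. *)
Lemma compat_of_digits g h rho s : sorts h rho s ->
  (of_digits g h \in compat c rho) = (g \in compat a s) && oddf h.
Proof.
move=> /sortsP hs; rewrite !inE odd_of_digits -!andbA; congr andb.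
rewrite andbC; congr andb.
apply: eq_forallb => x; apply: eq_forallb => y; congr (_ ==> _).
by rewrite !key_of_digits ltn_lex ?key_lt // [RHS]ltn_lex ?rank_lt // hs.
Qed.

Lemma card_digits rho s :
  #|[set f in compat c rho | sorts (lo_digit f) rho s]| =
  #|[set h : {ffun spt n -> 'I_(2 * b).+1} | oddf h && sorts h rho s]| * #|compat a s|.
Proof.
rewrite [RHS]mulnC -cardsX.
apply: (card_in_bij (f := fun f => (hi_digit f, lo_digit f))
                    (g := fun p => of_digits p.1 p.2)) => [f|[g h]|f _|[g h] _].
- rewrite inE => /andP[fc fs].
  by rewrite in_setX inE fs andbT -(compat_of_digits _ fs) of_digitsK.
- rewrite in_setX inE => /and3P[gc ho hs].
  by rewrite inE lo_of_digits hs andbT (compat_of_digits _ hs) gc.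
- exact: of_digitsK.
- by rewrite /= hi_of_digits lo_of_digits.
Qed.

End Digits.

(** Reading [h] along [s^-1] turns sorting by [s] into compatibility with rho after [s^-1], which
    the group writes [s^-1 * rho]. *)
Lemma card_sorted n b (rho s : {perm spt n}) : s \in Bn n ->
  #|[set h : {ffun spt n -> 'I_(2 * b).+1} | oddf h && sorts h rho s]| =
  #|compat b (s^-1 * rho)%g|.
Proof.
move=> sB; have sVB : (s^-1)%g \in Bn n by rewrite groupV.
pose F (t : {perm spt n}) (h : {ffun spt n -> 'I_(2 * b).+1}) :
  {ffun spt n -> 'I_(2 * b).+1} := [ffun x => h (t x)].
apply: (card_in_bij (f := F s^-1%g) (g := F s)) => [h|h|h _|h _].
- rewrite inE => /andP[/oddfP ho /sortsP hs]; apply/compatP; split.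
    by apply/oddfP => x; rewrite !ffunE Bn_neg.
  move=> x y; rewrite /key !ffunE !permM -/(key h rho _) -/(key h rho _).
  by rewrite -hs !permKV.
- move=> /compatP[/oddfP ho hs]; rewrite inE; apply/andP; split.
    by apply/oddfP => x; rewrite !ffunE Bn_neg.
  have E x : key (F s h) rho x = key h (s^-1 * rho)%g (s x).
    by rewrite /key ffunE permM permK.
  apply/sortsP => x y; rewrite !E.
  case: (ltngtP (rank (s x)) (rank (s y))) => [/hs -> //|/hs|/rank_inj ->].
    by lia.
  by rewrite ltnn.
- by apply/ffunP => x; rewrite !ffunE permK.
- by apply/ffunP => x; rewrite !ffunE permKV.
Qed.

(** Each function compatible with [rho] is counted at the unique [s] standardizing its low digit.
    For fixed [s], the high and low digits are then chosen independently. *)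
Lemma compat_convolution n a b (rho : {perm spt n}) : rho \in Bn n ->
  \sum_(s in Bn n) #|compat a s| * #|compat b (s^-1 * rho)%g| =
  #|compat (a * (2 * b + 1) + b) rho|.
Proof.
move=> rB; rewrite -sum1_card.
under [RHS]eq_bigr => f fc.
  rewrite -(@sum_sorts _ _ (lo_digit f) rho) //; last first.
    by move: fc; rewrite -{1}[f]of_digitsK inE odd_of_digits => /andP[/andP[]].
  over.
rewrite exchange_big /=; apply: eq_bigr => s sB.
rewrite mulnC -card_sorted // -card_digits -sum1_card big_mkcond [RHS]big_mkcond /=.
by apply: eq_bigr => f _; rewrite inE; case: (f \in _); case: sorts.
Qed.

(** * Carries *)

(** No entry exceeds the sum, so every range [B > M] gives the stars and bars count. *)
Lemma card_sum_leq n B M : M < B ->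
  #|[set z : {ffun 'I_n -> 'I_B} | \sum_(k < n) z k <= M]| = 'C(n + M, n).
Proof.
case: B => // B lMB; rewrite -card_partial_ord_partitions.
pose F (z : {ffun 'I_n -> 'I_B.+1}) : n.-tuple 'I_M.+1 :=
  [tuple inord (z k) | k < n].
pose G (t : n.-tuple 'I_M.+1) : {ffun 'I_n -> 'I_B.+1} :=
  [ffun k => inord (tnth t k)].
have zle (z : {ffun 'I_n -> 'I_B.+1}) k : \sum_(k < n) z k <= M -> z k < M.+1.
  by move=> lz; rewrite ltnS; apply: leq_trans lz; rewrite (bigD1 k) //= leq_addr.
have tle (t : n.-tuple 'I_M.+1) k : tnth t k < B.+1.
  by have := ltn_ord (tnth t k); lia.
apply: (card_in_bij (f := F) (g := G)) => [z|t|z|t]; rewrite !inE => H.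
- rewrite big_tuple; apply: leq_trans (H); apply: leq_sum => k _.
  by rewrite tnth_mktuple inordK ?zle //.
- apply: leq_trans H; rewrite big_tuple; apply: leq_sum => k _.
  by rewrite ffunE inordK.
- apply/ffunP => k; apply: val_inj; rewrite /= ffunE tnth_mktuple inordK inordK ?zle //.
- by apply: eq_from_tnth => k; apply: val_inj; rewrite /= tnth_mktuple inordK ffunE inordK.
Qed.

Lemma card_shifted_sum_leq n B M j : M < B -> j <= n ->
  #|[set z : {ffun 'I_n -> 'I_B} | j + \sum_(k < n) z k <= M]| =
  'C(n + M - j, n).
Proof.
move=> lMB jn; case: (leqP j M) => [jM|Mj].
  rewrite -addnBA // -(@card_sum_leq n B); last by lia.
  by apply: eq_card => z; rewrite !inE; lia.
rewrite bin_small; last by lia.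
by apply: eq_card0 => z; rewrite !inE; lia.
Qed.

Section Carries.
Variables (n b : nat).

Definition carry j (x : {ffun 'I_n -> 'I_(2 * b + 1)}) :=
  (j + b + \sum_(k < n) x k) %/ (2 * b + 1).

Lemma carry_le j x : j <= n -> carry j x <= n.
Proof.
move=> jn; rewrite -ltnS /carry ltn_divLR; last by lia.
have : \sum_(k < n) x k <= n * (2 * b).
  rewrite -[n in _ <= n * _]card_ord -sum_nat_const; apply: leq_sum => k _.
  by have := ltn_ord (x k); lia.
by move: (\sum_(_ < n) _) => X; nia.
Qed.

Lemma card_carries j : j <= n ->
  \sum_(i < n.+1) #|[set x | carry j x == i]| = (2 * b + 1) ^ n.
Proof.
move=> jn; rewrite -[in RHS](card_ord (2 * b + 1)) -[in RHS](card_ord n) -card_ffun.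
rewrite -sum1_card (partition_big (fun x => inord (carry j x) : 'I_n.+1) xpredT) //=.
apply: eq_bigr => i _; rewrite sum1dep_card; apply: eq_card => x.
rewrite !inE; apply/eqP/eqP => [->|<-]; first by rewrite inord_val.
by rewrite inordK // ltnS carry_le.
Qed.

Variable a : nat.
Let c := a * (2 * b + 1) + b.

Definition quo_part (z : {ffun 'I_n -> 'I_(a.+1 * (2 * b + 1))}) :
  {ffun 'I_n -> 'I_a.+1} := [ffun k => inord (z k %/ (2 * b + 1))].
Definition rem_part (z : {ffun 'I_n -> 'I_(a.+1 * (2 * b + 1))}) :
  {ffun 'I_n -> 'I_(2 * b + 1)} :=
  [ffun k => Ordinal (ltn_pmod (z k) (ltn_addl (2 * b) (ltn0Sn 0)))].

Lemma ltn_quo_rem (q : 'I_a.+1) (x : 'I_(2 * b + 1)) :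
  q * (2 * b + 1) + x < a.+1 * (2 * b + 1).
Proof. by have := ltn_ord q; have := ltn_ord x; nia. Qed.

Definition of_quo_rem (q : {ffun 'I_n -> 'I_a.+1})
    (x : {ffun 'I_n -> 'I_(2 * b + 1)}) : {ffun 'I_n -> 'I_(a.+1 * (2 * b + 1))} :=
  [ffun k => Ordinal (ltn_quo_rem (q k) (x k))].

Lemma of_quo_remK z : of_quo_rem (quo_part z) (rem_part z) = z.
Proof.
apply/ffunP => k; apply: val_inj; rewrite !ffunE /= inordK -?divn_eq //.
by rewrite ltn_divLR //; lia.
Qed.

Lemma quo_of_quo_rem q x : quo_part (of_quo_rem q x) = q.
Proof.
apply/ffunP => k; apply: val_inj; rewrite !ffunE /= divnMDl; last by lia.
by rewrite divn_small // addn0 inordK.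
Qed.

Lemma rem_of_quo_rem q x : rem_part (of_quo_rem q x) = x.
Proof.
by apply/ffunP => k; apply: val_inj; rewrite !ffunE /= modnMDl modn_small.
Qed.

(** Adding [b] to both sides turns the bound into a(2b+1) + 2b, the largest number with quotient [a]
    by 2b+1; the condition thus only concerns the quotient. *)
Lemma sum_of_quo_rem j q x :
  (j + \sum_(k < n) of_quo_rem q x k <= c) =
  (carry j x + \sum_(k < n) q k <= a).
Proof.
under eq_bigr => k _ do rewrite ffunE /=.
rewrite big_split /= -big_distrl /= /carry /c.
move: (\sum_(k < n) q k) (\sum_(k < n) x k) => Q X.
have := divn_eq (j + b + X) (2 * b + 1).
have : (j + b + X) %% (2 * b + 1) < 2 * b + 1 by rewrite ltn_mod; lia.
move: (_ %/ _) (_ %% _) => u v; nia.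
Qed.

(** Both sides count the vectors z with j + sum z <= c. Grouping by the carry i of the remainders
    leaves i + sum q <= a for the quotients. *)
Lemma carries_convolution j : j <= n ->
  \sum_(i < n.+1) #|[set x | carry j x == i]| * 'C(n + a - i, n) =
  'C(n + c - j, n).
Proof.
move=> jn; rewrite -(@card_shifted_sum_leq n (a.+1 * (2 * b + 1))) //; last first.
  by rewrite /c mulSn; lia.
rewrite -sum1_card (partition_big (fun z => inord (carry j (rem_part z)) : 'I_n.+1) xpredT) //=.
apply: eq_bigr => i _; have iN : i <= n by rewrite -ltnS.
rewrite -(@card_shifted_sum_leq n a.+1 a i) // -cardsX sum1dep_card.
apply/esym/(card_in_bij (f := fun z => (rem_part z, quo_part z))
                (g := fun p => of_quo_rem p.2 p.1)) => [z|[x q]|z _|[x q] _].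
- rewrite !inE /= -{1}[z]of_quo_remK sum_of_quo_rem => /andP[H /eqP/(congr1 val)/=].
  by rewrite inordK ?ltnS ?carry_le // => E; rewrite E eqxx -E.
- rewrite !inE /= sum_of_quo_rem rem_of_quo_rem => /andP[/eqP E H].
  by rewrite E H; apply/eqP/val_inj; rewrite /= inordK.
- by rewrite of_quo_remK.
- by rewrite /= rem_of_quo_rem quo_of_quo_rem.
Qed.

End Carries.

(* The matrix ['C(n + a - i, n)] (a, i <= n) is unitriangular. *)
Lemma binomial_triangular n (x y : nat -> nat) :
  (forall a, \sum_(i < n.+1) x i * 'C(n + a - i, n) =
             \sum_(i < n.+1) y i * 'C(n + a - i, n)) ->
  forall i, i <= n -> x i = y i.
Proof.
move=> H i; elim/ltn_ind: i => i IH lin.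
have li : i < n.+1 by [].
have := H i; rewrite (bigD1 (Ordinal li)) //= [RHS](bigD1 (Ordinal li)) //=.
rewrite addnK binn !muln1; suff -> : \sum_(k < n.+1 | k != Ordinal li) x k * 'C(n + i - k, n)
  = \sum_(k < n.+1 | k != Ordinal li) y k * 'C(n + i - k, n) by apply: addIn.
apply: eq_bigr => k; rewrite -val_eqE /= => nk.
case: (ltnP k i) => ki; first by rewrite IH //; lia.
by rewrite bin_small ?muln0 //; have := ltn_ord k; lia.
Qed.

Lemma partition_ndes (R : Type) (idx : R) (op : Monoid.com_law idx) n
    (F : {perm spt n.+1} -> R) :
  \big[op/idx]_(s in Bn n.+1) F s =
  \big[op/idx]_(j < n.+2) \big[op/idx]_(s in Bn n.+1 | ndes s == j) F s.
Proof.
rewrite (partition_big (fun s => inord (ndes s) : 'I_n.+2) xpredT) //=.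
apply: eq_bigr => j _; apply: eq_bigl => s.
case: (boolP (s \in Bn n.+1)) => //= sB; apply/eqP/eqP => [<-|->].
  by rewrite inordK // ltnS ndes_le.
by rewrite inord_val.
Qed.

Lemma shuffle_transition n b (rho : {perm spt n.+1}) i :
  rho \in Bn n.+1 -> i <= n.+1 ->
  \sum_(s in Bn n.+1 | ndes s == i) 'C(n.+1 + b - ndes (s^-1 * rho)%g, n.+1) =
  #|[set x | @carry n.+1 b (ndes rho) x == i]|.
Proof.
move=> rB; pose y i := #|[set x | @carry n.+1 b (ndes rho) x == i]|.
pose x i := \sum_(s in Bn n.+1 | ndes s == i)
              'C(n.+1 + b - ndes (s^-1 * rho)%g, n.+1).
rewrite -/(x i) -/(y i); apply: binomial_triangular => a.
rewrite carries_convolution ?ndes_le // -card_compat // -compat_convolution //.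
rewrite partition_ndes; apply: eq_bigr => k _; rewrite /x big_distrl /=.
apply: eq_bigr => s /andP[sB /eqP <-].
by rewrite !card_compat ?groupM ?groupV // mulnC.
Qed.

(** * Signed permutations counted by descents *)

Definition signed_perm n (p : {ffun 'I_n -> bool} * {perm 'I_n}) (x : spt n) : spt n :=
  (p.2 x.1, x.2 (+) p.1 x.1).

Lemma signed_perm_inj n p : injective (@signed_perm n p).
Proof. by move=> [i c] [j d] [/perm_inj <-] /addIb ->. Qed.

Lemma signed_perm_Bn n p : perm (@signed_perm_inj n p) \in Bn n.
Proof. by apply: BnP => x; rewrite !permE /signed_perm /negpt /= addNb. Qed.

Lemma card_Bn n : #|Bn n| = 2 ^ n * n`!.
Proof.
have F_inj : injective (fun p => perm (@signed_perm_inj n p)).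
  move=> [e p] [e' p'] E.
  have H i : signed_perm (e, p) (i, false) = signed_perm (e', p') (i, false).
    by have := congr1 (fun s : {perm spt n} => s (i, false)) E; rewrite !permE.
  congr pair; first by apply/ffunP => i; case: (H i).
  by apply/permP => i; case: (H i).
have -> : 2 ^ n * n`! = #|[set: {ffun 'I_n -> bool} * {perm 'I_n}]|.
  by rewrite cardsT card_prod card_ffun card_bool card_ord card_Sn.
rewrite -(card_imset _ F_inj); apply: eq_card => s; apply/idP/imsetP => [sB|[p _ ->]];
  last exact: signed_perm_Bn.
(* Equal absolute values mean equal or opposite images, hence equal or opposite points; two positive
   points are never opposite. *)
have s_inj : injective (fun i => (s (i, false)).1).
  move=> i j E; case: (eqVneq (s (i, false)).2 (s (j, false)).2) => [c|nc].
    by have /perm_inj[] := injective_projections _ _ E c.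
  have : s (i, false) = s (negpt (j, false)).
    rewrite Bn_neg //; apply: injective_projections => //=.
    by case: (s _).2 nc; case: (s _).2.
  by move/perm_inj.
exists ([ffun i => (s (i, false)).2], perm s_inj) => //.
have H i : s (i, false) = signed_perm ([ffun i => (s (i, false)).2], perm s_inj) (i, false).
  by rewrite /signed_perm /= ffunE permE; case: (s _).
apply/permP => -[i [|]]; rewrite permE //.
by have := Bn_neg (i, false) sB; rewrite H.
Qed.

(** For [a = 0] only the zero function is available, and it is compatible with [s] exactly when [s]
    preserves the order, i.e. is the identity. The count 'C(n+1-d(s), n+1) is nonzero exactly when
    d(s) = 0. *)
Lemma ndes_eq0 n (s : {perm spt n.+1}) : s \in Bn n.+1 -> (ndes s == 0) = (s == 1%g).
Proof.
move=> sB; pose z : {ffun spt n.+1 -> 'I_(2 * 0).+1} := [ffun=> ord0].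
have zodd : oddf z by apply/oddfP => x; rewrite !ffunE.
have kz t x : key z t x = rank (t x) by rewrite /key ffunE.
apply/eqP/eqP => [s0|->].
  have : 0 < #|compat 0 s| by rewrite card_compat // s0 addn0 subn0 binn.
  case/card_gt0P => f /compatP[_ fs].
  have H x y : rank x < rank y -> rank (s x) < rank (s y).
    by move/fs; rewrite /key !(ord1 (f _)).
  apply: (@standardization_unique _ (@rank _)) => x y; last by rewrite !perm1.
  case: (ltngtP (rank x) (rank y)) => [/H //|/H|/rank_inj ->]; last by rewrite ltnn.
  by lia.
have : 0 < #|compat (n := n.+1) 0 1|.
  by apply/card_gt0P; exists z; apply/compatP; split=> // x y; rewrite !kz !perm1.
rewrite card_compat ?group1 // addn0 bin_gt0.
by have := ndes_le (group1 (Bn_group n.+1)); lia.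
Qed.

Lemma ABE n j : AB n j = \sum_(s in Bn n | ndes s == j) 1.
Proof. by rewrite /AB -sum1_card; apply: eq_bigl => s; rewrite in_set. Qed.

Lemma AB0 n : AB n.+1 0 = 1.
Proof.
rewrite ABE (big_pred1 1%g) // => s /=.
case: (boolP (s \in Bn n.+1)) => sB; first by rewrite /= ndes_eq0.
by apply/esym/negbTE; apply: contra sB => /eqP ->; exact: group1.
Qed.

Lemma sum_ltn_nat m i : \sum_(k < m) (k < i) = minn m i.
Proof.
elim: m => [|m IH]; first by rewrite big_ord0 min0n.
by rewrite big_ord_recr /= IH; case: (ltnP m i) => /=; lia.
Qed.

(* Negating the first [i] points of the identity gives [i] descents. *)
Lemma AB_gt0 n i : i <= n.+1 -> 0 < AB n.+1 i.
Proof.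
move=> lin; pose p : {ffun 'I_n.+1 -> bool} * {perm 'I_n.+1} :=
  ([ffun k : 'I_n.+1 => k < i], 1%g).
apply/card_gt0P; exists (perm (@signed_perm_inj _ p)).
have sB := signed_perm_Bn p; rewrite inE sB ndesE //=.
apply/eqP; transitivity (\sum_(k < n.+1) (k < i)); last by rewrite sum_ltn_nat; lia.
apply: eq_bigr => k _; congr nat_of_bool.
rewrite /desc !permE /signed_perm /= !perm1 !ffunE /pt ltn_ord.
have lk := ltn_ord k; rewrite /rank /= inordK //.
case: (ltnP k.+1 n.+1) => lk1 /=; (rewrite !inordK; last by lia);
  case: (ltnP k i) => ki; case: ifP => H; lia.
Qed.

Lemma sum_AB n : \sum_(j < n.+2) AB n.+1 j = 2 ^ n.+1 * n.+1`!.
Proof.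
by rewrite -card_Bn -sum1_card partition_ndes; apply: eq_bigr => j _; rewrite ABE.
Qed.

(** * Shuffle transition probabilities and the stationary law of carries *)

Local Open Scope ring_scope.

(** Since [compose s m] is [m * s] in the group, the shuffle leading from [s] to [t] is [t * s^-1].
    Inverting [s] gives [shuffle_transition] at [rho = t^-1]. *)
Lemma QB_transition n b (t : {perm spt n.+1}) (i : 'I_n.+2) : t \in Bn n.+1 ->
  \sum_(s in Bn n.+1 | ndes (s^-1)%g == i) QB n.+1 b (t * s^-1)%g =
  carriesB n.+1 b (ndes (t^-1)%g) i.
Proof.
move=> tB; have tVB : (t^-1)%g \in Bn n.+1 by rewrite groupV.
rewrite /carriesB.
have := @shuffle_transition n b _ i tVB; rewrite -ltnS ltn_ord => /(_ isT).
rewrite /carry => <-; rewrite natr_sum mulr_suml (reindex_inj invg_inj) /=.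
apply: eq_big => s; first by rewrite groupV invgK.
by rewrite groupV invgK => _; rewrite /QB invMg.
Qed.

Lemma sum_carriesB n b j : (j <= n)%N -> \sum_(i < n.+1) carriesB n b j i = 1.
Proof.
move=> jn; rewrite -mulr_suml -natr_sum (@card_carries n b j jn) divff //.
by rewrite pnatr_eq0 expn_eq0; lia.
Qed.

(** At [t = 1], [QB_transition] splits the shuffle mass by descents into one row of the carries
    matrix. *)
Lemma sum_QB n b : \sum_(s in Bn n.+1) QB n.+1 b s = 1.
Proof.
rewrite -(@sum_carriesB n.+1 b (ndes (1%g : {perm spt n.+1})^-1%g)); last first.
  by rewrite ndes_le // groupV group1.
under [RHS]eq_bigr => i _ do rewrite -QB_transition ?group1 //.
have EB s : (s^-1%g \in Bn n.+1) = (s \in Bn n.+1) by rewrite groupV.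
rewrite partition_ndes; apply: eq_bigr => i _; rewrite [RHS](reindex_inj invg_inj) /=.
by apply: eq_big => [s|s _]; rewrite ?EB invgK ?mul1g.
Qed.

(** Sum [QB_transition] over all [t]. For fixed [s] the shuffles [t * s^-1] run over the whole group
    with total mass 1, so what remains is a count of the [s] with d(s^-1) = i. *)
Lemma carriesB_stationary n b (i : 'I_n.+2) :
  \sum_(j < n.+2) (AB n.+1 j)%:R * carriesB n.+1 b j i = (AB n.+1 i)%:R :> rat.
Proof.
have EB s : (s^-1%g \in Bn n.+1) = (s \in Bn n.+1) by rewrite groupV.
transitivity (\sum_(t in Bn n.+1) carriesB n.+1 b (ndes (t^-1)%g) i).
  rewrite [RHS](reindex_inj invg_inj) /=; under [RHS]eq_bigl do rewrite groupV.
  rewrite partition_ndes.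
  apply: eq_bigr => j _; rewrite ABE natr_sum mulr_suml; apply: eq_bigr => s.
  by move=> /andP[_ /eqP <-]; rewrite invgK mul1r.
under eq_bigr => t tB do rewrite -QB_transition //.
rewrite exchange_big /= ABE natr_sum.
transitivity (\sum_(s in Bn n.+1 | ndes (s^-1)%g == i) (1 : rat)); last first.
  rewrite (reindex_inj invg_inj) /=; apply: eq_bigl => s.
  by rewrite EB invgK.
apply: eq_bigr => s /andP[sB _]; rewrite -(sum_QB n b) (reindex_inj (mulIg s)) /=.
by apply: eq_big => [t|t _]; rewrite ?groupMr ?mulgK.
Qed.

(** * Path probabilities *)

Lemma big_tuple_cons (R : Type) (idx : R) (op : Monoid.com_law idx)
    (T : finType) r (P : pred (r.+1.-tuple T)) (F : r.+1.-tuple T -> R) :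
  \big[op/idx]_(t | P t) F t =
  \big[op/idx]_x \big[op/idx]_(t : r.-tuple T | P [tuple of x :: t])
    F [tuple of x :: t].
Proof.
rewrite pair_big_dep /= (reindex (fun p : T * r.-tuple T => [tuple of p.1 :: p.2])) //=.
exists (fun t => (thead t, [tuple of behead t])) => [[x t] _|t _] /=.
  by congr pair; apply: val_inj.
by rewrite [RHS]tuple_eta.
Qed.

(** Splits off the first shuffle, whereas [tau] is defined by splitting off the last. *)
Lemma tau_cons n (m : {perm spt n}) mu k : tau (m :: mu) k.+1 = (tau mu k * m)%g.
Proof.
elim: k => [|k IH]; first by rewrite /= /compose mulg1 mul1g.
by rewrite -[LHS]/(compose (tau (m :: mu) k.+1) (nth 1%g mu k)) IH /compose mulgA.
Qed.

(** [path_prob] with start [s]; indexing [J] by [nat] makes dropping the first state a shift. *)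
Definition paths_from n b r (J : nat -> nat) (s : {perm spt n}) : rat :=
  \sum_(mu : r.-tuple {perm spt n} | all (fun s => s \in Bn n) mu)
    (\prod_(k < r) QB n b (tnth mu k)) *
    ([forall k : 'I_r.+1, ndes (tau mu k * s)^-1%g == J k] : bool)%:R.

Lemma paths_from0 n b J s : @paths_from n b 0 J s = (ndes s^-1%g == J 0%N)%:R.
Proof.
rewrite /paths_from (big_pred1 [tuple]) => [|t]; last by rewrite tuple0; apply/esym/eqP.
rewrite big_ord0 mul1r; congr (nat_of_bool _)%:R.
apply/forallP/idP => [/(_ ord0)|H k]; first by rewrite /= mul1g.
by rewrite ord1 /= mul1g.
Qed.

Lemma paths_fromS n b r J s :
  @paths_from n b r.+1 J s = (ndes s^-1%g == J 0%N)%:R *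
    \sum_(m in Bn n) QB n b m * paths_from b r (fun k => J k.+1) (m * s)%g.
Proof.
rewrite /paths_from big_tuple_cons mulr_sumr [RHS]big_mkcond /=.
apply: eq_bigr => m _; case: ifP => mB; last by rewrite big_pred0.
rewrite !mulr_sumr; apply: eq_bigr => mu _.
have -> : [forall k, ndes (tau (m :: mu) (k : 'I_r.+2) * s)^-1%g == J k] =
    (ndes s^-1%g == J 0%N) &&
    [forall k, ndes (tau mu (k : 'I_r.+1) * (m * s))^-1%g == J k.+1].
  apply/forallP/andP => [H|[H0 /forallP H] k].
    split; first by have := H ord0; rewrite /= mul1g.
    apply/forallP => k; have := H (lift ord0 k).
    by rewrite [nat_of_ord _]/= tau_cons -mulgA.
  case: (unliftP ord0 k) => [k' ->|->]; last by rewrite /= mul1g.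
  by rewrite [nat_of_ord _]/= tau_cons -mulgA H.
rewrite big_ord_recl tnth0.
case: (ndes _ == _) => /=; rewrite ?mulr1n ?mulr0n ?mul1r ?mulr0 ?mul0r // mulrA.
by congr (_ * _ * _); apply: eq_bigr => k _; congr QB; rewrite !(tnth_nth 1%g).
Qed.

Lemma paths_from_supp n b r J (s : {perm spt n}) :
  ndes s^-1%g != J 0%N -> paths_from b r J s = 0.
Proof.
by move=> /negbTE H; case: r => [|r]; rewrite ?paths_from0 ?paths_fromS H ?mul0r.
Qed.

(* Starting from every signed permutation makes the induction on the first step
   work; at [J 0 = 0] only the identity contributes. *)
Lemma sum_paths_from n b r J : (forall k, J k <= n.+1)%N ->
  \sum_(s in Bn n.+1) paths_from b r J s =
  (AB n.+1 (J r))%:R * \prod_(k < r) carriesB n.+1 b (J k.+1) (J k).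
Proof.
elim: r J => [|r IH] J lJ.
  rewrite big_ord0 mulr1 ABE natr_sum (reindex_inj invg_inj) /= [RHS]big_mkcondr /=.
  apply: eq_big => [s|s _]; first by rewrite groupV.
  by rewrite paths_from0 invgK; case: eqP.
rewrite big_ord_recl mulrCA -(IH (fun k => J k.+1)) // mulr_sumr.
under eq_bigr => s _ do rewrite paths_fromS.
(* The first shuffle m is replaced by the state [t = m * s] that it reaches. *)
transitivity (\sum_(s in Bn n.+1) \sum_(t in Bn n.+1)
   (ndes s^-1%g == J 0%N)%:R * QB n.+1 b (t * s^-1)%g * paths_from b r (fun k => J k.+1) t).
  apply: eq_bigr => s sB; rewrite mulr_sumr (reindex_inj (mulIg s^-1%g)) /=.
  by apply: eq_big => [t|t _]; rewrite ?groupMr ?groupV // mulgKV mulrA.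
rewrite exchange_big /=; apply: eq_bigr => t tB; rewrite -mulr_suml.
(* Only states with d(t^-1) = J 1 contribute, and for all of them the mass arriving from d(s^-1) = J
   0 is the same carries probability. *)
case: (eqVneq (ndes t^-1%g) (J 1%N)) => [Et|nt]; last by rewrite paths_from_supp ?mulr0.
congr (_ * _); rewrite -Et.
have l0 : (J 0%N < n.+2)%N by rewrite ltnS lJ.
rewrite -(QB_transition b (Ordinal l0) tB) /= [RHS]big_mkcondr /=.
by apply: eq_bigr => s _; case: eqP; rewrite ?mul1r ?mul0r.
Qed.

Lemma prod_ratio (F : fieldType) (f p : nat -> F) r : (forall k, f k != 0) ->
  \prod_(k < r) (f k.+1 * p k / f k) = f r / f 0%N * \prod_(k < r) p k.
Proof.
move=> f0; elim: r => [|r IH]; first by rewrite !big_ord0 divff // mul1r.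
by rewrite !big_ord_recr /= IH; field; rewrite !f0.
Qed.

Lemma path_probE n b r (j : 'I_r.+1 -> 'I_n.+2) :
  path_prob n.+1 b r j = (nat_of_ord (j ord0) == 0%N)%:R *
    ((AB n.+1 (j (inord r)))%:R *
     \prod_(k < r) carriesB n.+1 b (j (inord k.+1)) (j (inord k))).
Proof.
pose J k : nat := j (inord k).
have -> : path_prob n.+1 b r j = @paths_from n.+1 b r J 1%g.
  apply: eq_bigr => mu _; congr (_ * (nat_of_bool _)%:R).
  by apply: eq_forallb => k; rewrite mulg1 /J inord_val.
have n1 : ndes (1%g : {perm spt n.+1})^-1%g = 0%N.
  by apply/eqP; rewrite ndes_eq0 ?groupV ?group1 // invg1.
have -> : nat_of_ord (j ord0) = J 0%N.
  by rewrite /J; congr (nat_of_ord (j _)); apply: val_inj; rewrite /= inordK.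
rewrite -/(J r) -(sum_paths_from b r (J := J)); last by move=> k; rewrite -ltnS ltn_ord.
case: (eqVneq (J 0%N) 0%N) => J0; last by rewrite paths_from_supp ?mul0r // n1 eq_sym.
rewrite mul1r (bigD1 1%g) ?group1 //= big1 ?addr0 // => s /andP[sB ns].
by rewrite paths_from_supp // J0 ndes_eq0 ?groupV // invg_eq1.
Qed.

Theorem theorem4p3 (n b : nat) (hn : (1 <= n)%N) (hb : (1 <= b)%N) :
  exists K : 'I_n.+1 -> 'I_n.+1 -> rat,
    (* K is a transition matrix on {0,...,n} *)
    (forall i j, 0 <= K i j) /\
    (forall i, \sum_(j < n.+1) K i j = 1) /\
    (* (d(tau_r^-1))_{r>=0} is a Markov chain with transition matrix K
       (started at d(id) = 0) *)
    (forall (r : nat) (j : 'I_r.+1 -> 'I_n.+1),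
        path_prob n b r j =
        ((nat_of_ord (j ord0) == 0%N) : bool)%:R *
        \prod_(k < r) K (j (inord k)) (j (inord k.+1))) /\
    (* pi is a stationary distribution of K *)
    (\sum_(j < n.+1) piB n j = 1) /\
    (forall j : 'I_n.+1, \sum_(i < n.+1) piB n i * K i j = piB n j) /\
    (* time reversal of K w.r.t. pi is the type B carries chain *)
    (forall i j : 'I_n.+1, K i j = piB n j * carriesB n b j i / piB n i).
Proof.
case: n hn => // n _.
have N0 : (2 ^ n.+1 * n.+1`!)%N%:R != 0 :> rat.
  by rewrite pnatr_eq0 muln_eq0 expn_eq0 -lt0n fact_gt0.
have A0 i : (i <= n.+1)%N -> (AB n.+1 i)%:R != 0 :> rat.
  by move=> li; rewrite pnatr_eq0 -lt0n AB_gt0.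
have p0 (i : 'I_n.+2) : piB n.+1 i != 0.
  by rewrite mulf_neq0 ?invr_eq0 // A0 // -ltnS.
have pi_ge0 i : 0 <= piB n.+1 i by rewrite divr_ge0.
have c0 i j : 0 <= carriesB n.+1 b i j by rewrite divr_ge0.
exists (fun i j => piB n.+1 j * carriesB n.+1 b j i / piB n.+1 i).
(* The normalization of [piB] cancels in the ratio. *)
have KE (i j : 'I_n.+2) : piB n.+1 j * carriesB n.+1 b j i / piB n.+1 i =
    (AB n.+1 j)%:R * carriesB n.+1 b j i / (AB n.+1 i)%:R.
  rewrite /piB; move: N0 (A0 i (ltn_ord i)); move: (_%:R) => d; move: (_%:R) => u.
  by move=> d0 u0; field; rewrite u0 d0.
split; first by move=> i j; exact: divr_ge0 (mulr_ge0 _ _) _.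
split.
  move=> i; under eq_bigr => j _ do rewrite KE.
  by rewrite -mulr_suml carriesB_stationary divff // A0 // -ltnS.
split.
  move=> r j; rewrite path_probE; case: eqP => j0; last by rewrite !mul0r.
  rewrite !mul1r; under [RHS]eq_bigr => k _ do rewrite KE.
  (* The ratios of descent counts telescope to the last count over the first, which is 1 since the
     path starts at 0. *)
  rewrite (prod_ratio (f := fun k => (AB n.+1 (j (inord k)))%:R)
     (fun k => carriesB n.+1 b (j (inord k.+1)) (j (inord k)))); last first.
    by move=> k; rewrite A0 // -ltnS.
  have -> : inord 0 = ord0 :> 'I_r.+1 by apply: val_inj; rewrite /= inordK.
  by rewrite j0 AB0 divr1.
split; first by rewrite -mulr_suml -natr_sum sum_AB divff.
split=> // j.
(* Cancelling [piB] at [i] reduces stationarity to a row sum of the carries matrix. *)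
under eq_bigr => i _ do rewrite mulrC divfK //.
by rewrite -mulr_sumr sum_carriesB ?mulr1 // -ltnS.
Qed.
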